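(* Let $\mathcal{T}_n \subseteq \mathbb{C}^{n\times n}$ be the affine variety of $n\times n$ Toeplitz matrices. Then, for every $A \in \mathbb{C}^{n\times n}$, $$\underline{\mathbf{FL}}_{\mathcal{T}_n}(A) \geq \left\lceil \frac{\operatorname{rank}(\nabla_{Z_0}(A))}{2}\right\rceil \quad\text{and}\quad \underline{\mathbf{FL}}_{\mathcal{T}_n}(A) \geq \left\lceil \frac{\operatorname{rank}(\nabla_{Z_1,Z_0}(A))}{2}\right\rceil.$$ In particular, for every integer $r\ge 1$ and for an $n\times n$ matrix $X$ whose entries are $n^2$ independent variables, the $(2r+1)$-minors of $\nabla_{Z_0}(X)$ and of $\nabla_{Z_1,Z_0}(X)$ (viewed as polynomials in the entries of $X$) are equations vanishing on $\mu_r(\mathcal{T}_n)$.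
   Context: A matrix is Toeplitz if its $(i,j)$-entry depends only on $j-i$. For $s \in \mathbb{C}$, $Z_s$ denotes the $n\times n$ matrix $$Z_s = \begin{bmatrix} 0 & & & s\\ 1 & 0 & & \\ & \ddots & \ddots & \\ & & 1 & 0\end{bmatrix},$$ i.e. the entries $(i+1,i)$, $1\le i\le n-1$, equal $1$, the $(1,n)$-entry equals $s$, and all other entries are $0$. For $P,Q \in \mathbb{C}^{n\times n}$, $\nabla_{P,Q}(A) = PA - AQ$, and $\nabla_Q = \nabla_{Q,Q}$. For an affine variety $Y \subseteq \mathbb{C}^{n\times n}$ and an integer $k \geq 1$, $\mu_k(Y)$ is the Zariski closure in $\mathbb{C}^{n\times n}$ of $\{M_1\cdots M_k : M_1,\dots,M_k \in Y\}$, and the border $Y$-factorization length is $\underline{\mathbf{FL}}_Y(A) = \min\{k \geq 1 : A \in \mu_k(Y)\}$ ($=\infty$ if there is no such $k$). A $(2r+1)$-minor is the determinant of a $(2r+1)\times(2r+1)$ submatrix. *)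

(* Defs.v *)
From HB Require Import structures.
From mathcomp Require Import all_boot all_order all_algebra.
From mathcomp Require Import boolp classical_sets reals constructive_ereal.
From mathcomp Require Import complex.
(* The notations of [mpoly] clash with those of [classical_sets]. *)
From mathcomp Require Import -(notations) mpoly.

Set Implicit Arguments.
Unset Strict Implicit.
Unset Printing Implicit Defensive.

Import Order.TTheory GRing.Theory Num.Theory.

Local Open Scope classical_set_scope.
Local Open Scope ring_scope.

Definition toeplitz (F : fieldType) (n : nat) : set 'M[F]_n :=
  [set A | forall i j k l : 'I_n,
     j%:Z - i%:Z = l%:Z - k%:Z -> A i j = A k l].

(* When n = 1 the corner entry (1, n) is the only entry and Z_s = [s]. *)
Definition Zmx (S : pzRingType) (n : nat) (s : S) : 'M[S]_n :=
  \matrix_(i, j) if i == j.+1 :> nat then 1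
                 else if (i == 0 :> nat) && (j.+1 == n) then s
                 else 0.

Definition nabla (S : pzRingType) (n : nat) (P Q A : 'M[S]_n) : 'M[S]_n :=
  P *m A - A *m Q.

(* Polynomials in the n^2 entries of an n x n matrix: the entry (i, j) is the
   variable numbered [mxvec_index i j]. *)
Definition mxpolynomial (F : fieldType) (n : nat) := mpoly (n * n) F.

Definition generic_mx (F : fieldType) (n : nat) : 'M[mxpolynomial F n]_n :=
  \matrix_(i, j) mpolyX F (mnm1 (mxvec_index i j)).

Definition mxpoly_eval (F : fieldType) (n : nat) (A : 'M[F]_n)
    (p : mxpolynomial F n) : F :=
  meval (mxvec A 0) p.

Definition zero_locus (F : fieldType) (n : nat) (I : set (mxpolynomial F n)) :
    set 'M[F]_n :=
  [set A | forall p, I p -> mxpoly_eval A p = 0].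

Definition zariski_closed (F : fieldType) (n : nat) (Y : set 'M[F]_n) : Prop :=
  exists I : set (mxpolynomial F n), Y = zero_locus I.

Definition zariski_closure (F : fieldType) (n : nat) (Y : set 'M[F]_n) :
    set 'M[F]_n :=
  smallest (@zariski_closed F n) Y.

Definition mu (F : fieldType) (n : nat) (Y : set 'M[F]_n) (k : nat) :
    set 'M[F]_n :=
  zariski_closure
    [set \prod_(i < k) M i | M in [set M : 'I_k -> 'M[F]_n | forall i, Y (M i)]].

(* min {k >= 1 : A \in mu_k(Y)}, or +oo when there is no such k. *)
Definition border_FL (R : realType) (n : nat) (Y : set 'M[R[i]]_n)
    (A : 'M[R[i]]_n) : \bar R :=
  if pselect (exists k, (0 < k)%N && `[< mu Y k A >]) is left ex_k
  then (ex_minn ex_k)%:R%:E else +oo%E.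

Definition is_minor (S : comPzRingType) (n k : nat) (A : 'M[S]_n) (d : S) :
    Prop :=
  exists f g : 'I_k -> 'I_n,
    [/\ {homo f : i j / (i < j)%N}, {homo g : i j / (i < j)%N}
      & d = \det (mxsub f g A)].

(* Main.v *)
Require Import Defs.
From HB Require Import structures.
From mathcomp Require Import all_boot all_order all_algebra.
From mathcomp Require Import boolp classical_sets reals constructive_ereal.
From mathcomp Require Import complex.
From mathcomp Require Import -(notations) mpoly.
From mathcomp Require Import ring.

(** A Toeplitz matrix [T] is constant along its diagonals, and the shift
    [Zmx n 0] moves entries along them.  Hence [Zmx n s *m T] and
    [T *m Zmx n 0] agree outside the first row and the last column, and the
    displacement [nabla (Zmx n s) (Zmx n 0) T] has rank at most 2
    ([mxrank_nabla_toeplitz]).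

    The displacement obeys the Leibniz rule
    [nabla P Q (A *m B) = nabla P S A *m B + A *m nabla S Q B] for every
    intermediate [S].  Taking [S = Zmx n 0], each factor of a product of [k]
    Toeplitz matrices contributes at most 2 to the rank, so the displacement of
    the product has rank at most [2 * k] ([mxrank_nabla_prod]).

    Rank bounds survive Zariski closure, because the rank of a matrix is at most
    [r] exactly when all its square submatrices of size greater than [r] have
    determinant zero, and for a matrix depending polynomially on [A] these
    determinants are polynomials in the entries of [A]
    ([zariski_closed_mxrank_le]).  So the rank bound
    [2 * k] holds on all of [mu (@toeplitz F n) k] ([mxrank_nabla_mu]).  Both
    assertions of the theorem follow: the lower bound on the border
    factorization length is the inequality [rank <= 2 * k] divided by 2, and the
    minors of size [2 * r + 1] vanish because they exceed the rank. *)

Set Implicit Arguments.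
Unset Strict Implicit.
Unset Printing Implicit Defensive.

Import Order.TTheory GRing.Theory Num.Theory.

Local Open Scope classical_set_scope.
Local Open Scope ring_scope.

(** * Rank and minors *)

Lemma det_mxsub_eq0 (F : fieldType) (m n k : nat) (A : 'M[F]_(m, n))
    (f : 'I_k -> 'I_m) (g : 'I_k -> 'I_n) :
  (\rank A < k)%N -> \det (mxsub f g A) = 0.
Proof.
move=> ltAk; apply/eqP; apply: contraTT ltAk => det_neq0.
have unitA : mxsub f g A \in unitmx by rewrite unitmxE unitfE.
rewrite -leqNgt -{1}(mxrank_unit unitA) mxsubcr -[X in (\rank X <= _)%N]trmxK.
rewrite mxrank_tr trmx_mxsub (leq_trans (mxrankS (rowsub_sub _ _)))//.
by rewrite mxrank_tr (mxrankS (rowsub_sub _ _)).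
Qed.

(** Independent rows that span the row space form a matrix of full rank; picking
    independent columns of that matrix makes it square and invertible. *)
Lemma exists_det_mxsub_neq0 (F : fieldType) (m n : nat) (A : 'M[F]_(m, n)) :
  exists (f : 'I_(\rank A) -> 'I_m) (g : 'I_(\rank A) -> 'I_n),
    \det (mxsub f g A) != 0.
Proof.
have full : row_full (rowsub (maxrankfun A) A)^T.
  by rewrite /row_full mxrank_tr; apply: maxrowsub_free.
exists (maxrankfun A), (fullrankfun full).
have := fullrowsub_unit full; rewrite unitmxE unitfE -det_tr.
by congr (\det _ != 0); apply/matrixP => i j; rewrite !mxE.
Qed.

Lemma mxrank_leP (F : fieldType) (m n r : nat) (A : 'M[F]_(m, n)) :
  (\rank A <= r)%N <->
  forall k (f : 'I_k -> 'I_m) (g : 'I_k -> 'I_n),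
    (r < k)%N -> \det (mxsub f g A) = 0.
Proof.
split=> [leAr k f g ltrk|minors0].
  exact/det_mxsub_eq0/(leq_ltn_trans leAr).
have [f [g]] := exists_det_mxsub_neq0 A.
by rewrite leqNgt; apply: contraNN => ltrA; rewrite minors0.
Qed.

(** The two terms of the decomposition are the row [i0] of [A], and the column
    [j0] of what remains. *)
Lemma mxrank_cross (F : fieldType) (m n : nat) (A : 'M[F]_(m, n))
    (i0 : 'I_m) (j0 : 'I_n) :
  (forall i j, i != i0 -> j != j0 -> A i j = 0) -> (\rank A <= 2)%N.
Proof.
move=> A0; pose B := A - delta_mx i0 0 *m row i0 A.
have -> : A = delta_mx i0 (0 : 'I_1) *m row i0 A + col j0 B *m delta_mx 0 j0.
  apply/matrixP => i j; rewrite !mxE !big_ord1 !mxE big_ord1 !mxE !eqxx andbT /=.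
  have [->|neq_i] := eqVneq i i0; first by rewrite !mul1r subrr mul0r addr0.
  rewrite !mul0r subr0 add0r.
  by have [->|neq_j] := eqVneq j j0; rewrite ?mulr1 // mulr0 A0.
apply: leq_trans (mxrank_add _ _) _.
exact: leq_add (mulmx_max_rank _ _) (mulmx_max_rank _ _).
Qed.

(** * Displacement of products of Toeplitz matrices *)

Lemma Zmx_mulE (S : pzRingType) (n : nat) (s : S) (A : 'M[S]_n)
    (i i' j : 'I_n) :
  i = i'.+1 :> nat -> (Zmx n s *m A) i j = A i' j.
Proof.
move=> eq_i; rewrite mxE (bigD1 i') //= mxE eq_i eqxx mul1r big1 ?addr0 //.
move=> k neq_k; rewrite mxE eq_i eqSS eq_sym.
by rewrite (negPf (neq_k : k != i' :> nat)) mul0r.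
Qed.

Lemma mul_Zmx0E (S : pzRingType) (n : nat) (A : 'M[S]_n) (i j j' : 'I_n) :
  j' = j.+1 :> nat -> (A *m Zmx n 0) i j = A i j'.
Proof.
move=> eq_j; rewrite mxE (bigD1 j') //= mxE eq_j eqxx mulr1 big1 ?addr0 //.
move=> k neq_k; rewrite mxE -eq_j (negPf (neq_k : k != j' :> nat)).
by case: ifP => _; rewrite mulr0.
Qed.

(** Off the first row and the last column, the entry [(i, j)] of the displacement
    is [T (i - 1) j - T i (j + 1)], a difference along one diagonal. *)
Lemma mxrank_nabla_toeplitz (F : fieldType) (n : nat) (s : F) (T : 'M[F]_n) :
  toeplitz T -> (\rank (nabla (Zmx n s) (Zmx n 0) T) <= 2)%N.
Proof.
case: n T => [|n] T toepT; first exact: leq_trans (rank_leq_row _) _.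
apply: (@mxrank_cross _ _ _ _ ord0 ord_max) => i j neq_i neq_j.
have [i' eq_i] : exists i' : 'I_n.+1, i = i'.+1 :> nat.
  by case: i neq_i => -[//|i] lt_i _; exists (Ordinal (ltnW lt_i)).
have [j' eq_j] : exists j' : 'I_n.+1, j' = j.+1 :> nat.
  have lt_j : (j < n)%N by rewrite ltn_neqAle neq_j -ltnS ltn_ord.
  by exists (Ordinal (lt_j : j.+1 < n.+1)%N).
rewrite mxE [X in _ + X]mxE (Zmx_mulE s T j eq_i) (mul_Zmx0E T i eq_j).
apply/eqP; rewrite subr_eq0; apply/eqP/toepT.
by rewrite eq_i eq_j !intS; ring.
Qed.

Lemma nablaM (S : pzRingType) (n : nat) (P Q R A B : 'M[S]_n) :
  nabla P Q (A *m B) = nabla P R A *m B + A *m nabla R Q B.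
Proof.
by rewrite /nabla mulmxBl mulmxBr !mulmxA addrA subrK.
Qed.

(** The operator [Q] on the right of the first factor is also the intermediate
    operator that separates the factors in the Leibniz rule; this is why the
    other factors are displaced by [nabla Q Q] only. *)
Lemma mxrank_nabla_prod (F : fieldType) (n r k : nat) (P Q : 'M[F]_n)
    (M : 'I_k.+1 -> 'M[F]_n) :
  (forall i, \rank (nabla P Q (M i)) <= r)%N ->
  (forall i, \rank (nabla Q Q (M i)) <= r)%N ->
  (\rank (nabla P Q (\prod_(i < k.+1) M i)%R) <= r * k.+1)%N.
Proof.
elim: k P M => [|k IHk] P M leP leQ; first by rewrite big_ord1 muln1.
rewrite big_ord_recl -mulmxE (nablaM _ _ Q) mulnS.
apply: leq_trans (mxrank_add _ _) (leq_add _ _).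
  exact: leq_trans (mxrankM_maxl _ _) (leP _).
by apply: leq_trans (mxrankM_maxr _ _) (IHk _ _ _ _) => i; apply: leQ.
Qed.

(** * Passing to the Zariski closure *)

HB.instance Definition _ (F : fieldType) (n : nat) (A : 'M[F]_n) :=
  GRing.RMorphism.copy (@mxpoly_eval F n A) (meval (mxvec A 0)).

Lemma map_generic_mx (F : fieldType) (n : nat) (A : 'M[F]_n) :
  map_mx (mxpoly_eval A) (generic_mx F n) = A.
Proof. by apply/matrixP => i j; rewrite !mxE /mxpoly_eval mevalXU mxvecE. Qed.

Lemma map_Zmx (S S' : pzRingType) (h : {rmorphism S -> S'}) (n : nat) (s : S) :
  map_mx h (Zmx n s) = Zmx n (h s).
Proof.
by apply/matrixP => i j; rewrite !mxE; do 2?case: ifP; rewrite ?rmorph1 ?rmorph0.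
Qed.

Lemma map_nabla (S S' : pzRingType) (h : {rmorphism S -> S'}) (n : nat)
    (P Q A : 'M[S]_n) :
  map_mx h (nabla P Q A) = nabla (map_mx h P) (map_mx h Q) (map_mx h A).
Proof. by rewrite map_mxB !map_mxM. Qed.

Lemma map_nabla_Zmx_generic (F : fieldType) (n : nat) (A : 'M[F]_n)
    (s t : mxpolynomial F n) :
  map_mx (mxpoly_eval A) (nabla (Zmx n s) (Zmx n t) (generic_mx F n)) =
  nabla (Zmx n (mxpoly_eval A s)) (Zmx n (mxpoly_eval A t)) A.
Proof. by rewrite map_nabla !map_Zmx map_generic_mx. Qed.

Lemma zariski_closed_mxrank_le (F : fieldType) (n r m m' : nat)
    (B : 'M[mxpolynomial F n]_(m, m')) :
  zariski_closed
    [set A : 'M[F]_n | (\rank (map_mx (mxpoly_eval A) B) <= r)%N].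
Proof.
exists [set p | exists k (f : 'I_k -> 'I_m) (g : 'I_k -> 'I_m'),
                  (r < k)%N /\ p = \det (mxsub f g B)].
apply/seteqP; split=> A /=.
  move/mxrank_leP => minors0 _ [k [f [g [ltrk ->]]]].
  by rewrite -det_map_mx map_mxsub minors0.
move=> vanish; apply/mxrank_leP => k f g ltrk.
by rewrite -map_mxsub det_map_mx; apply: vanish; exists k, f, g.
Qed.

(** The empty product must be excluded: the displacement of the identity,
    [nabla (Zmx n s) (Zmx n 0) 1], carries [s] in its top right corner. *)
Lemma mxrank_nabla_mu (F : fieldType) (n k : nat) (s : mxpolynomial F n)
    (A : 'M[F]_n) :
  (0 < k)%N -> mu (@toeplitz F n) k A ->
  (\rank (map_mx (mxpoly_eval A)
            (nabla (Zmx n s) (Zmx n 0) (generic_mx F n))) <= 2 * k)%N.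
Proof.
case: k => // k _.
apply: (smallest_sub (zariski_closed_mxrank_le (2 * k.+1) _)).
move=> _ [M /= toepM <-]; rewrite map_nabla_Zmx_generic rmorph0.
by apply: mxrank_nabla_prod => i; apply: mxrank_nabla_toeplitz.
Qed.

(** * The border factorization length *)

Lemma le_border_FL (R : realType) (n : nat) (Y : set 'M[R[i]]_n)
    (A : 'M[R[i]]_n) (x : \bar R) :
  (forall k, (0 < k)%N -> mu Y k A -> (x <= k%:R%:E)%E) ->
  (x <= border_FL Y A)%E.
Proof.
move=> le_x; rewrite /border_FL; case: pselect => [ex_k|_]; last exact: leey.
by case: ex_minnP => k /andP[k_gt0 /asboolP muA] _; apply: le_x.
Qed.

Lemma ceil_half_le (R : realType) (r k : nat) :
  (r <= 2 * k)%N -> (((Num.ceil (r%:R / 2 : R))%:~R)%:E <= (k%:R : R)%:E)%E.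
Proof.
move=> le_rk; rewrite lee_fin -[k%:R]/((k%:Z)%:~R) ler_int ceil_le_int.
by rewrite ler_pdivrMr ?ltr0n // -natrM ler_nat mulnC.
Qed.

Theorem corollary4p19 (R : realType) (n : nat) :
  (forall A : 'M[R[i]]_n,
     (((Num.ceil ((\rank (nabla (Zmx n 0) (Zmx n 0) A))%:R / 2 : R))%:~R)%:E
        <= border_FL (@toeplitz R[i] n) A)%E
     /\
     (((Num.ceil ((\rank (nabla (Zmx n 1) (Zmx n 0) A))%:R / 2 : R))%:~R)%:E
        <= border_FL (@toeplitz R[i] n) A)%E)
  /\
  (forall r : nat, (1 <= r)%N ->
     let X := generic_mx R[i] n in
     forall p : mxpolynomial R[i] n,
       is_minor (2 * r).+1 (nabla (Zmx n 0) (Zmx n 0) X) p \/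
       is_minor (2 * r).+1 (nabla (Zmx n 1) (Zmx n 0) X) p ->
       forall A : 'M[R[i]]_n, mu (@toeplitz R[i] n) r A -> mxpoly_eval A p = 0).
Proof.
split=> [A|r r_ge1 X p minor_p A muA].
  split; apply: le_border_FL => k k_gt0 muA; apply: ceil_half_le.
    by have := mxrank_nabla_mu 0 k_gt0 muA; rewrite map_nabla_Zmx_generic rmorph0.
  by have := mxrank_nabla_mu 1 k_gt0 muA;
    rewrite map_nabla_Zmx_generic rmorph0 rmorph1.
case: minor_p => -[f [g [_ _ ->]]]; rewrite -det_map_mx map_mxsub;
  exact/det_mxsub_eq0/mxrank_nabla_mu.
Qed.
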